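(* Let $p>1$ and let $\mathcal{B}=(B_1,\dots,B_m)$ be an $m$-tuple of real symmetric $n\times n$ matrices such that $m\ge n$, each $B_i$ is nonzero and positive semidefinite, each $B_i$ has rank at most $r$ (where $1\le r\le n$), and $\sum_{i=1}^mB_i$ has full rank. Then there exists a symmetric positive definite matrix $B_*\in\mathbb{R}^{n\times n}$ such that for every $x\in\mathbb{R}^n$ $$\|x\|_{B_*}^2\ \le\ \left(\sum_{i=1}^m\langle B_ix,x\rangle^p\right)^{1/p}\ \le\ n^{1-\frac1p}\,\|x\|_{B_*}^2 .$$
   Context: For a symmetric positive definite matrix $B$, $\|x\|_B=\langle Bx,x\rangle^{1/2}$. *)

(* Defs.v *)
From HB Require Import structures.
From mathcomp Require Import all_boot all_order all_algebra.
From mathcomp Require Import sesquilinear.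
From mathcomp Require Import reals exp.

Set Implicit Arguments.
Unset Strict Implicit.
Unset Printing Implicit Defensive.

Import Order.TTheory GRing.Theory Num.Theory.

Local Open Scope ring_scope.

Definition inner (R : realType) (n : nat) (u v : 'cV[R]_n) : R :=
  \sum_(i < n) u i 0 * v i 0.

Definition qform (R : realType) (n : nat) (B : 'M[R]_n) (x : 'cV[R]_n) : R :=
  inner (B *m x) x.

Definition possemidefmx (R : realType) (n : nat) (B : 'M[R]_n) : Prop :=
  B \is symmetricmx /\ forall x : 'cV[R]_n, 0 <= qform B x.

Definition posdefmx (R : realType) (n : nat) (B : 'M[R]_n) : Prop :=
  B \is symmetricmx /\ forall x : 'cV[R]_n, x != 0 -> 0 < qform B x.

Definition normB (R : realType) (n : nat) (B : 'M[R]_n) (x : 'cV[R]_n) : R :=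
  Num.sqrt (qform B x).

Lemma symmetricmxE (R : realType) (n : nat) (B : 'M[R]_n) :
  (B \is symmetricmx) = (B == B^T).
Proof. by rewrite is_hermitianmxE expr0 scale1r map_mx_id. Qed.

(* Main.v *)
(* With [q] the conjugate exponent of [p], let [c] maximize [|det (sum_i c_i B_i)|] over
   [c >= 0], [sum_i c_i^q <= 1], and take [Bstar = A = sum_i c_i B_i]. The lower bound is
   Hoelder's inequality. For the upper bound, [|det (A + C)| >= |det A| (1 + <Cx,x> / <Ax,x>)]
   for positive semidefinite [C]; comparing [c] with a renormalization of [c + e e_i] and letting
   [e] tend to 0 gives [<B_i x,x> <= n c_i^(q-1) <Ax,x>]. Multiplying the [(p-1)]-th power of
   this by [<B_i x,x>] and summing over [i] gives the claim, as [(p-1)(q-1) = 1]. *)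

Require Import Defs.
From mathcomp Require Import all_boot all_order all_algebra.
From mathcomp Require Import sesquilinear perm ring lra.
From mathcomp Require Import boolp classical_sets functions reals topology normedtype.
From mathcomp Require Import sequences derive exp.

Import Order.TTheory GRing.Theory Num.Theory.
Import numFieldNormedType.Exports.

Local Open Scope classical_set_scope.
Local Open Scope ring_scope.

(** * Quadratic forms and determinants *)

Section QuadraticForms.
Variables (R : realType) (n : nat).
Implicit Types (A B C : 'M[R]_n) (u v w x y : 'cV[R]_n).

Lemma inner_mx u v : inner u v = (v^T *m u) 0 0.
Proof. by rewrite mxE; apply: eq_bigr => i _; rewrite mxE mulrC. Qed.

Lemma innerC u v : inner u v = inner v u.
Proof. by apply: eq_bigr => i _; rewrite mulrC. Qed.

Lemma innerDl u v w : inner (u + v) w = inner u w + inner v w.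
Proof. by rewrite !inner_mx mulmxDr mxE. Qed.

Lemma innerDr u v w : inner w (u + v) = inner w u + inner w v.
Proof. by rewrite !(innerC w) innerDl. Qed.

Lemma innerZl k u v : inner (k *: u) v = k * inner u v.
Proof. by rewrite !inner_mx -scalemxAr mxE. Qed.

Lemma innerZr k u v : inner u (k *: v) = k * inner u v.
Proof. by rewrite !(innerC u) innerZl. Qed.

Lemma inner_self_eq0 u : inner u u = 0 -> u = 0.
Proof.
move=> /eqP; rewrite psumr_eq0 => [/allP u0|i _]; last by rewrite -expr2 sqr_ge0.
apply/colP => i; rewrite mxE; apply/eqP.
by have := u0 i (mem_index_enum i); rewrite mulf_eq0 orbb.
Qed.

Lemma qform_mx B x : qform B x = (x^T *m B *m x) 0 0.
Proof. by rewrite /qform inner_mx mulmxA. Qed.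

Lemma qformD B C x : qform (B + C) x = qform B x + qform C x.
Proof. by rewrite /qform mulmxDl innerDl. Qed.

Lemma qformZ k B x : qform (k *: B) x = k * qform B x.
Proof. by rewrite /qform -scalemxAl innerZl. Qed.

Lemma qform_0r B : qform B 0 = 0.
Proof. by rewrite qform_mx mulmx0 mxE. Qed.

Lemma qform_sum (I : finType) (B : I -> 'M[R]_n) x :
  qform (\sum_i B i) x = \sum_i qform (B i) x.
Proof.
by rewrite qform_mx mulmx_sumr mulmx_suml summxE; apply: eq_bigr => i _; rewrite qform_mx.
Qed.

Lemma symmetricmx_tr B : B \is symmetricmx -> B^T = B.
Proof. by rewrite symmetricmxE => /eqP <-. Qed.

Lemma symmetricmx_of_tr B : B^T = B -> B \is symmetricmx.
Proof. by rewrite symmetricmxE => ->. Qed.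

Lemma inner_symm B x y : B \is symmetricmx -> inner (B *m x) y = inner (B *m y) x.
Proof.
move=> /symmetricmx_tr Bs.
by rewrite innerC !inner_mx trmx_mul Bs mulmxA.
Qed.

Lemma qform_lincomb B s t x y : B \is symmetricmx ->
  qform B (s *: x + t *: y) =
  s ^+ 2 * qform B x + 2 * s * t * inner (B *m x) y + t ^+ 2 * qform B y.
Proof.
move=> Bs; rewrite /qform mulmxDr -!scalemxAr !(innerDl, innerDr, innerZl, innerZr).
rewrite (inner_symm _ y x Bs); ring.
Qed.

Lemma Cauchy_Schwarz_psd B x y : possemidefmx B ->
  inner (B *m x) y ^+ 2 <= qform B x * qform B y.
Proof.
move=> [Bs Bge0]; set b := inner _ _.
have := Bge0 y; rewrite le_eqVlt => /predU1P[By0|By_gt0].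
  (* The form takes the value [- b ^+ 2 * (qform B x + 2)] here, which forces [b = 0]. *)
  have := Bge0 (b *: x + (- qform B x - 1) *: y).
  rewrite qform_lincomb // -/b -By0 !mulr0 addr0 => h.
  have := Bge0 x; have := sqr_ge0 b; nra.
(* Here the value is [qform B y * (qform B x * qform B y - b ^+ 2)]. *)
have := Bge0 (qform B y *: x + (- b) *: y).
rewrite qform_lincomb // -/b => h.
by rewrite -subr_ge0 -(pmulr_rge0 _ By_gt0); lra.
Qed.

(** Cauchy-Schwarz against [y = B *m x] makes the squared length of [B *m x] vanish. *)
Lemma psd_qform_eq0 B x : possemidefmx B -> qform B x = 0 -> B *m x = 0.
Proof.
move=> Bpsd Bx0; apply: inner_self_eq0; apply/eqP; rewrite -sqrf_eq0 eq_le sqr_ge0 andbT.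
by have := Cauchy_Schwarz_psd B x (B *m x) Bpsd; rewrite Bx0 mul0r.
Qed.

Lemma posdefmx_psd B : posdefmx B -> possemidefmx B.
Proof.
move=> [Bs Bgt0]; split=> // x; have [->|/Bgt0/ltW //] := eqVneq x 0.
by rewrite qform_0r.
Qed.

Lemma posdefmx_det B : posdefmx B -> \det B != 0.
Proof.
move=> [Bs Bgt0]; apply/negP => /det0P[v v0 vB].
have := Bgt0 v^T; rewrite trmx_eq0 => /(_ v0).
by rewrite qform_mx trmxK vB mul0mx mxE ltxx.
Qed.

Lemma psd_posdefmx B : possemidefmx B -> \det B != 0 -> posdefmx B.
Proof.
move=> Bpsd detB; split=> [|x x0]; first by case: Bpsd.
rewrite lt_neqAle (proj2 Bpsd) andbT eq_sym; apply: contra x0 => /eqP Bx0.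
have Bu : B \in unitmx by rewrite unitmxE unitfE.
by rewrite -(mulKmx Bu x) (psd_qform_eq0 B x Bpsd Bx0) mulmx0.
Qed.

Lemma possemidefmxD B C : possemidefmx B -> possemidefmx C -> possemidefmx (B + C).
Proof.
move=> [/symmetricmx_tr Bs B0] [/symmetricmx_tr Cs C0]; split=> [|x].
  by apply: symmetricmx_of_tr; rewrite linearD /= Bs Cs.
by rewrite qformD addr_ge0.
Qed.

Lemma possemidefmxZ k B : 0 <= k -> possemidefmx B -> possemidefmx (k *: B).
Proof.
move=> k0 [/symmetricmx_tr Bs B0]; split=> [|x].
  by apply: symmetricmx_of_tr; rewrite linearZ /= Bs.
by rewrite qformZ mulr_ge0.
Qed.

Lemma possemidefmx_sum (I : finType) (B : I -> 'M[R]_n) :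
  (forall i, possemidefmx (B i)) -> possemidefmx (\sum_i B i).
Proof.
move=> Bpsd; apply: big_ind => // [|C D Cp Dp]; last exact: possemidefmxD.
split=> [|x]; first by rewrite symmetricmxE trmx0.
by rewrite /qform mul0mx inner_mx mulmx0 mxE.
Qed.

Lemma posdefmxD B C : posdefmx B -> possemidefmx C -> posdefmx (B + C).
Proof.
move=> Bp Cp; split=> [|x x0]; first by case: (possemidefmxD B C (posdefmx_psd B Bp) Cp).
by rewrite qformD ltr_wpDr ?(proj2 Cp) ?(proj2 Bp).
Qed.

Lemma qform_rank_one u x : qform (u *m u^T) x = inner u x ^+ 2.
Proof.
rewrite qform_mx mulmxA -[_ *m x]mulmxA mxE big_ord1 -!inner_mx.
by rewrite (innerC x) expr2.
Qed.

Lemma rank_one_psd k u : 0 <= k -> possemidefmx (k *: (u *m u^T)).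
Proof.
move=> k0; apply: possemidefmxZ => //; split=> [|x].
  by apply: symmetricmx_of_tr; rewrite trmx_mul trmxK.
by rewrite qform_rank_one sqr_ge0.
Qed.

(** * Determinants under positive semidefinite perturbations *)

(** Multiplying the bordered matrix [M] by the same unipotent block matrix on the left and on the
    right gives two block triangular matrices, whose determinants are the two sides. *)
Lemma det_1D_rank_one u v : \det (1%:M + u *m v^T) = 1 + inner u v.
Proof.
pose M := block_mx 1%:M (- v^T) u (1%:M : 'M[R]_n).
have E1 : block_mx 1%:M 0 (- u) 1%:M *m M = block_mx 1%:M (- v^T) 0 (1%:M + u *m v^T).
  by rewrite mulmx_block !(mul1mx, mulmx1, mul0mx) mulNmx mulmxN opprK !addr0 addNr addrC.
have E2 : M *m block_mx 1%:M 0 (- u) 1%:M = block_mx (1%:M + v^T *m u) (- v^T) 0 1%:M.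
  by rewrite mulmx_block !(mul1mx, mulmx1, mulmx0) mulNmx mulmxN opprK subrr !add0r.
have := congr1 (@determinant R _) E1; have := congr1 (@determinant R _) E2.
rewrite !det_mulmx !det_lblock !det_ublock !det1 !mul1r !mulr1 => -> <-.
by rewrite det_mx11 mxE [X in X + _]mxE inner_mx.
Qed.

(** Factoring out [A] leaves a rank-one update of the identity, of determinant [1 + k * qform A w]
    with [A *m w = u]; Cauchy-Schwarz for [A] bounds [qform A w] from below. Absolute values make
    the sign of [\det A] irrelevant. *)
Lemma posdefmx_normdet_rank_one A k u x : posdefmx A -> 0 <= k -> 0 < qform A x ->
  `|\det A| * (1 + k * inner u x ^+ 2 / qform A x) <= `|\det (A + k *: (u *m u^T))|.
Proof.
move=> Ap k0 Ax.
have Au : A \in unitmx by rewrite unitmxE unitfE posdefmx_det.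
pose w := invmx A *m u; have uE : u = A *m w by rewrite mulKVmx.
have -> : A + k *: (u *m u^T) = A *m (1%:M + (k *: w) *m u^T).
  by rewrite mulmxDr mulmx1 -scalemxAl -scalemxAr mulmxA -uE.
rewrite det_mulmx normrM det_1D_rank_one ler_wpM2l //.
apply: le_trans (ler_norm _); rewrite lerD2l innerZl -mulrA ler_wpM2l //.
have -> : inner w u = qform A w by rewrite innerC uE.
rewrite ler_pdivrMr // uE.
exact/Cauchy_Schwarz_psd/posdefmx_psd.
Qed.

(** One step of symmetric elimination in the direction [x]: when [qform C x] is positive, the
    subtracted rank-one matrix has the same value as [C] at [x], and [x] enters the kernel. *)
Definition deflate C x : 'M[R]_n :=
  C - (qform C x)^-1 *: ((C *m x) *m (C *m x)^T).

Lemma deflate_psd C x : possemidefmx C -> 0 < qform C x -> possemidefmx (deflate C x).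
Proof.
move=> Cp Cx; have [/symmetricmx_tr Cs C0] := Cp; split=> [|y].
  rewrite /deflate; set u := C *m x.
  by apply: symmetricmx_of_tr; rewrite linearB linearZ /= trmx_mul trmxK Cs.
rewrite /deflate -scaleNr qformD qformZ qform_rank_one mulNr subr_ge0 mulrC.
by rewrite ler_pdivrMr // mulrC Cauchy_Schwarz_psd.
Qed.

(** The row space of [deflate C x] lies in that of [C], strictly, because [x] is killed by the
    former and not by the latter. *)
Lemma rank_deflate C x : possemidefmx C -> 0 < qform C x ->
  (\rank (deflate C x) < \rank C)%N.
Proof.
move=> Cp Cx; have /symmetricmx_tr Cs := proj1 Cp.
have CxT : (C *m x)^T = x^T *m C by rewrite trmx_mul Cs.
apply: rank_ltmx; rewrite ltmxE; apply/andP; split.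
  have -> : deflate C x = (1%:M - (qform C x)^-1 *: ((C *m x) *m x^T)) *m C.
    by rewrite /deflate CxT mulmxBl mul1mx -scalemxAl mulmxA.
  exact: submxMl.
apply/negP => /submxP[D CD].
have dx : deflate C x *m x = 0.
  rewrite /deflate CxT mulmxBl -scalemxAl -(mulmxA (C *m x)) (mx11_scalar (x^T *m C *m x)).
  by rewrite -qform_mx mul_mx_scalar scalerA mulVf ?gt_eqF // scale1r subrr.
by move: Cx; rewrite /qform CD -mulmxA dx mulmx0 inner_mx mulmx0 mxE ltxx.
Qed.

(* Peeling off rank-one summands one at a time avoids the spectral theorem. *)
Lemma posdefmx_normdet_le A C : posdefmx A -> possemidefmx C ->
  `|\det A| <= `|\det (A + C)|.
Proof.
have [k] := ubnP (\rank C); elim: k A C => // k IH A C rk Ap Cp.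
have [C0|[x Cx]] : C = 0 \/ exists x, 0 < qform C x.
  have [->|Cn0] := eqVneq C 0; first by left.
  right; have [x Cx] : exists x, C *m x != 0.
    have [j] : exists j, col j C != 0.
      apply/existsP; rewrite -negb_forall; apply: contra Cn0 => /forallP Cj.
      by apply/eqP/matrixP => i j; have /eqP/colP/(_ i) := Cj j; rewrite !mxE.
    by rewrite colE => ?; exists (delta_mx j 0).
  exists x; rewrite lt_neqAle (proj2 Cp) andbT eq_sym; apply: contra Cx => /eqP.
  by move=> /(psd_qform_eq0 C x Cp) ->.
  by rewrite C0 addr0.
(* [A + D] replaces [A] in the induction hypothesis, hence the induction over all [A]. *)
pose D := (qform C x)^-1 *: ((C *m x) *m (C *m x)^T).
have D0 : possemidefmx D by apply: rank_one_psd; rewrite invr_ge0 ltW.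
have -> : A + C = A + D + deflate C x by rewrite /deflate -/D -addrA (addrC D) subrK.
apply: (@le_trans _ _ `|\det (A + D)|); last first.
  apply: IH; last exact: deflate_psd.
  - exact: leq_trans (rank_deflate _ _ Cp Cx) _.
  - exact: posdefmxD.
have Ax : 0 < qform A x.
  by apply: (proj2 Ap); apply: contraTneq Cx => ->; rewrite qform_0r ltxx.
apply: le_trans (posdefmx_normdet_rank_one _ _ _ x Ap _ Ax); last by rewrite invr_ge0 ltW.
by rewrite ler_peMr // lerDl !mulr_ge0 ?sqr_ge0 ?invr_ge0 ?ltW.
Qed.

(** The rank-one part [D] of [C] already yields the whole factor, since its form agrees with that of
    [C] at [x]; adding the remainder [deflate C x] cannot decrease the absolute determinant. *)
Lemma posdefmx_normdetD A C x : posdefmx A -> possemidefmx C -> 0 < qform A x ->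
  `|\det A| * (1 + qform C x / qform A x) <= `|\det (A + C)|.
Proof.
move=> Ap Cp Ax; have := proj2 Cp x; rewrite le_eqVlt => /predU1P[<-|Cx].
  by rewrite mul0r addr0 mulr1 posdefmx_normdet_le.
pose D := (qform C x)^-1 *: ((C *m x) *m (C *m x)^T).
have D0 : possemidefmx D by apply: rank_one_psd; rewrite invr_ge0 ltW.
have -> : A + C = A + D + deflate C x by rewrite /deflate -/D -addrA (addrC D) subrK.
apply: le_trans (posdefmx_normdet_le _ _ (posdefmxD _ _ Ap D0) (deflate_psd _ _ Cp Cx)).
have Cx' : 0 <= (qform C x)^-1 by rewrite invr_ge0 ltW.
apply: le_trans (posdefmx_normdet_rank_one _ _ _ x Ap Cx' Ax).
by rewrite -/(qform C x) expr2 mulrA mulVf ?mul1r // gt_eqF.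
Qed.

End QuadraticForms.

(** * Maximizing the determinant *)

(** [powR] takes default values at negative bases; the absolute value gives a function continuous on
    the whole line that agrees with the power on nonnegative numbers. *)
Lemma continuous_norm_powR (R : realType) (r : R) : 0 < r ->
  continuous (fun x : R => `|x| `^ r).
Proof.
move=> r0 x; have [->|x0] := eqVneq x 0.
  rewrite /continuous_at normr0 powR0 ?gt_eqF //.
  apply/cvgr0Pnorm_lt => e e0; near=> t.
  rewrite ger0_norm ?powR_ge0 //.
  have -> : e = (e `^ r^-1) `^ r by rewrite -powRrM mulVf ?gt_eqF // powRr1 // ltW.
  apply: gt0_ltr_powR => //; rewrite ?nnegrE ?powR_ge0 //.
  by near: t; apply: (@cvgr0_norm_lt _ _ _ _ _ id) => //; rewrite powR_gt0.
apply: (@continuous_comp _ _ _ (fun x : R => `|x|) (fun x => x `^ r)).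
  exact: norm_continuous.
apply: differentiable_continuous; apply/derivable1_diffP.
by apply: derivable_powR; rewrite in_itv /= andbT normr_gt0.
Unshelve. all: by end_near. Qed.

Lemma continuous_bigsum (R : realType) (T : topologicalType) (I : Type) (s : seq I) (P : pred I)
    (f : I -> T -> R) : (forall i, continuous (f i)) ->
  continuous (fun x => \sum_(i <- s | P i) f i x).
Proof.
move=> fc; apply: (@continuous_big R I +%R 0 P _ T s f) => [|i _]; last exact: fc.
exact: add_continuous.
Qed.

Lemma continuous_bigprod (R : realType) (T : topologicalType) (I : Type) (s : seq I) (P : pred I)
    (f : I -> T -> R) : (forall i, continuous (f i)) ->
  continuous (fun x => \prod_(i <- s | P i) f i x).
Proof.
move=> fc; apply: (@continuous_big R I *%R 1 P _ T s f) => [|i _]; last exact: fc.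
exact: mul_continuous.
Qed.

(** By the Leibniz formula the determinant is polynomial in the entries, which are linear in [c]. *)
Lemma continuous_det_pencil (R : realType) (m n : nat) (B : 'I_m -> 'M[R]_n) :
  continuous (fun c : 'rV[R]_m => \det (\sum_i c 0 i *: B i)).
Proof.
have entry i j : continuous (fun c : 'rV[R]_m => (\sum_k c 0 k *: B k) i j).
  have -> : (fun c : 'rV[R]_m => (\sum_k c 0 k *: B k) i j) =
            (fun c => \sum_k c 0 k * B k i j).
    by apply/funext => c; rewrite summxE; apply: eq_bigr => k _; rewrite mxE.
  apply: (continuous_bigsum R _ _ _ _ (fun k (c : 'rV[R]_m) => c 0 k * B k i j)) => k c.
  apply: (@continuousM R _ (fun c : 'rV[R]_m => c 0 k) (fun=> B k i j)).
    exact: coord_continuous.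
  exact: cst_continuous.
rewrite /determinant.
apply: (continuous_bigsum R _ _ (index_enum (perm_type 'I_n)) xpredT (fun s (c : 'rV[R]_m) =>
  (-1) ^+ s * \prod_i (\sum_k c 0 k *: B k) i (s i))) => s c.
apply: (@continuousM R _ (fun=> (-1) ^+ s)
  (fun c : 'rV[R]_m => \prod_i (\sum_k c 0 k *: B k) i (s i))); first exact: cst_continuous.
exact: (continuous_bigprod R _ _ _ _ (fun i (c : 'rV[R]_m) => (\sum_k c 0 k *: B k) i (s i))).
Qed.

Lemma normdet_max (R : realType) (q : R) (m n : nat) (B : 'I_m -> 'M[R]_n) : 0 < q ->
  exists c : 'rV[R]_m, [/\ forall i, 0 <= c 0 i, \sum_i c 0 i `^ q <= 1 &
   forall d : 'rV[R]_m, (forall i, 0 <= d 0 i) -> \sum_i d 0 i `^ q <= 1 ->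
     `|\det (\sum_i d 0 i *: B i)| <= `|\det (\sum_i c 0 i *: B i)|].
Proof.
move=> q0.
(* The constraint already puts each entry in [[0, 1]], so intersecting with the box loses no
   admissible point and gives compactness. *)
pose box := [set c : 'rV[R]_m | forall i, (`[0, 1]%classic : set R) (c ord0 i)].
pose K := box `&` [set c : 'rV[R]_m | \sum_i `|c 0 i| `^ q <= 1].
have Kc : compact K.
  apply: compact_closedI.
    by apply: (@rV_compact R m (fun=> `[0, 1]%classic)) => i; apply: segment_compact.
  apply: (@preimage_closed _ _ (fun c : 'rV[R]_m => \sum_i `|c 0 i| `^ q)
    [set x : R | x <= 1]) => [c _|].
    apply: continuous_bigsum => i {}c.
    apply: (@continuous_comp _ _ _ (fun c : 'rV[R]_m => c 0 i) (fun x => `|x| `^ q)).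
      exact: coord_continuous.
    exact: continuous_norm_powR.
  exact: closed_le.
have KE (d : 'rV[R]_m) : (forall i, 0 <= d 0 i) -> \sum_i d 0 i `^ q <= 1 -> K d.
  move=> d0 d1; split=> [i|] /=.
    rewrite in_itv /= d0 /= leNgt; apply/negP => di.
    suff : 1 `^ q < \sum_i d 0 i `^ q by rewrite powR1 ltNge d1.
    rewrite (bigD1 i) //= ltr_wpDr ?sumr_ge0 // => [j _|]; first exact: powR_ge0.
    by apply: gt0_ltr_powR; rewrite ?nnegrE.
  by under eq_bigr do rewrite ger0_norm //.
have K0 : K !=set0.
  exists 0; apply: KE => [i|]; first by rewrite mxE.
  by rewrite big1 // => i _; rewrite mxE powR0 ?gt_eqF.
have fc : {within K, continuous (fun c : 'rV[R]_m => `|\det (\sum_i c 0 i *: B i)|)}.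
  by apply: continuous_subspaceT => c; exact: (@continuous_comp _ R R _ _ c
    (continuous_det_pencil _ _ _ B c) (@norm_continuous _ R _)).
have [c /set_mem [cbox c1] cmax] := @EVT_max_rV R m _ K K0 Kc fc.
have c0 i : 0 <= c 0 i by have := cbox i; rewrite /= in_itv => /andP[].
exists c; split=> // [|d d0 d1]; last by apply: cmax; apply/mem_set/KE.
by move: c1 => /=; under eq_bigr do rewrite ger0_norm //.
Qed.

(** Tangent-line bound for the convex power at [y], obtained from Young's inequality for the product
    of [x] and [y ^ (q - 1)], multiplied by [q]. *)
Lemma powR_sub_le (R : realType) (q x y : R) : 1 < q -> 0 <= x -> 0 <= y ->
  y `^ q - x `^ q <= q * y `^ (q - 1) * (y - x).
Proof.
move=> q1 x0 y0; pose p := q / (q - 1).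
have q0 : 0 < q by lra.
have q10 : 0 < q - 1 by lra.
have p0 : 0 < p by rewrite divr_gt0.
have qp : q^-1 + p^-1 = 1 by rewrite /p; field; rewrite !gt_eqF.
have := conjugate_powR x0 (powR_ge0 y (q - 1)) q0 p0 qp.
rewrite -powRrM.
have -> : (q - 1) * p = q by rewrite /p; field; rewrite gt_eqF.
rewrite -(ler_pM2l q0) => young.
have e : q * (x `^ q / q + y `^ q / p) = x `^ q + (q - 1) * y `^ q.
  by rewrite /p; field; rewrite !gt_eqF.
rewrite e in young; have yq := mulr_powRB1 y0 q0.
rewrite mulrBr -[_ * _ * y]mulrA (mulrC _ y) yq; lra.
Qed.

(** Compares both sides to first order as [e] tends to 0 from the right. No derivative at [x] is
    taken, so the boundary case [x = 0] is included. *)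
Lemma stationary_bound (R : realType) (n : nat) (q x b : R) : 1 < q -> 0 <= x -> 0 <= b ->
  (forall e, 0 < e -> 1 + e * b <= (1 + ((x + e) `^ q - x `^ q)) `^ (n%:R / q)) ->
  b <= n%:R * x `^ (q - 1).
Proof.
move=> q1 x0 b0 H.
have q10 : 0 < q - 1 by lra.
have q0 : 0 < q by lra.
have {}H e : 0 < e -> b <= n%:R * `|x + e| `^ (q - 1) * (1 + e * b).
  move=> e0; have y0 : 0 <= x + e by lra.
  rewrite ger0_norm //; set g := n%:R * _.
  (* Uses [ln (1 + d) <= d] and then the tangent-line bound on [d], whose factor [q] cancels the one
     in [n%:R / q]. *)
  have {}H : 1 + e * b <= expR (e * g).
    apply: le_trans (H _ e0) _; set d := _ - _.
    have d0 : 0 <= d.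
      by rewrite subr_ge0; apply: ge0_ler_powR; rewrite ?nnegrE ?(ltW q0) //; lra.
    have d1 : 0 < 1 + d by lra.
    rewrite /powR gt_eqF // ler_expR.
    have nq : 0 <= n%:R / q by rewrite divr_ge0 // ltW.
    apply: (@le_trans _ _ (n%:R / q * d)).
      by rewrite ler_wpM2l // le_ln1Dx // (lt_le_trans _ d0) // ltrN10.
    apply: (@le_trans _ _ (n%:R / q * (q * (x + e) `^ (q - 1) * (x + e - x)))).
      by rewrite ler_wpM2l // powR_sub_le.
    rewrite le_eqVlt; apply/orP; left; apply/eqP; rewrite /g; field.
    by rewrite gt_eqF.
  (* Replacing the exponential by its linear lower bound gives [(1 + e * b) * (1 - e * g) <= 1];
     dividing by [e] then leaves [b <= g * (1 + e * b)]. *)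
  have h1 : 1 - e * g <= expR (- (e * g)) := expR_ge1Dx _.
  have h2 : (1 + e * b) * expR (- (e * g)) <= 1.
    by rewrite expRN ler_pdivrMr ?expR_gt0 // mul1r.
  have h3 : (1 + e * b) * (1 - e * g) <= 1.
    by apply: le_trans h2; rewrite ler_wpM2l // addr_ge0 // mulr_ge0 // ltW.
  by rewrite -(ler_pM2l e0); lra.
pose h := fun e : R => n%:R * `|x + e| `^ (q - 1) * (1 + e * b).
have hc : h e @[e --> 0^'+] --> h 0.
  apply: cvg_at_right_filter.
  apply: (@continuousM R _ (fun e : R => n%:R * `|x + e| `^ (q - 1)) (fun e => 1 + e * b)).
    apply: (@continuousM R _ (fun=> n%:R) (fun e : R => `|x + e| `^ (q - 1))).
      exact: cst_continuous.
    apply: (@continuous_comp _ _ _ (fun e : R => x + e) (fun y => `|y| `^ (q - 1))).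
      by apply: (@continuousD R R R (fun=> x) id); [exact: cst_continuous|exact: cvg_id].
    exact: continuous_norm_powR.
  apply: (@continuousD R R R (fun=> 1) (fun e => e * b)); first exact: cst_continuous.
  by apply: (@continuousM R _ id (fun=> b)); [exact: cvg_id|exact: cst_continuous].
have -> : n%:R * x `^ (q - 1) = h 0 by rewrite /h addr0 mul0r addr0 mulr1 ger0_norm.
apply: (cvgr_to_ge hc).
by near=> e; apply: H.
Unshelve. all: by end_near. Qed.

Lemma normdet_max_stationary (R : realType) (q : R) (m n : nat) (B : 'I_m -> 'M[R]_n)
    (c : 'rV[R]_m) : 1 < q -> (forall i, possemidefmx (B i)) ->
  (forall i, 0 <= c 0 i) -> \sum_i c 0 i `^ q <= 1 ->
  (forall d : 'rV[R]_m, (forall i, 0 <= d 0 i) -> \sum_i d 0 i `^ q <= 1 ->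
     `|\det (\sum_i d 0 i *: B i)| <= `|\det (\sum_i c 0 i *: B i)|) ->
  posdefmx (\sum_i c 0 i *: B i) ->
  forall i x, qform (B i) x <= n%:R * c 0 i `^ (q - 1) * qform (\sum_i c 0 i *: B i) x.
Proof.
move=> q1 Bpsd c0 c1 cmax; set A := \sum_i _ => Ap i x.
have q0 : 0 < q by lra.
have [->|x0] := eqVneq x 0; first by rewrite !qform_0r mulr0.
have Ax : 0 < qform A x by apply: (proj2 Ap).
rewrite -ler_pdivrMr //.
apply: stationary_bound => // [|e e0].
  by rewrite divr_ge0 ?(proj2 (Bpsd i)) // ltW.
(* [s] bounds the sum of [q]-th powers after [c 0 i] is raised by [e], so scaling by [s ^ (- 1/q)]
   makes [d] admissible. *)
set s := 1 + (_ - _).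
have s0 : 0 < s.
  suff h : c 0 i `^ q <= (c 0 i + e) `^ q by rewrite /s; lra.
  by have ci := c0 i; apply: ge0_ler_powR; rewrite ?nnegrE ?(ltW q0) //; lra.
pose d : 'rV[R]_m := \row_j (s `^ (- q^-1) * (c 0 j + e *+ (j == i))).
have ce j : 0 <= c 0 j + e *+ (j == i) by rewrite addr_ge0 // mulrn_wge0 // ltW.
have d0 j : 0 <= d 0 j by rewrite mxE mulr_ge0 // powR_ge0.
have d1 : \sum_j d 0 j `^ q <= 1.
  have dq j : d 0 j `^ q = s `^ (-1) * (c 0 j + e *+ (j == i)) `^ q.
    by rewrite mxE powRM ?powR_ge0 // -powRrM mulNr mulVf ?(gt_eqF q0).
  rewrite (eq_bigr _ (fun j _ => dq j)) -mulr_sumr powR_inv1 ?(ltW s0) // mulrC.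
  rewrite ler_pdivrMr // mul1r.
  have c1' : c 0 i `^ q + \sum_(j | j != i) c 0 j `^ q <= 1 by move: c1; rewrite (bigD1 i).
  rewrite (bigD1 i) //= eqxx mulr1n.
  under eq_bigr => j ji do rewrite (negPf ji) mulr0n addr0.
  rewrite /s; lra.
have := cmax d d0 d1; rewrite -/A.
have -> : \sum_j d 0 j *: B j = s `^ (- q^-1) *: (A + e *: B i).
  have -> : e *: B i = \sum_j (e *+ (j == i)) *: B j.
    rewrite (bigD1 i) //= eqxx mulr1n big1 ?addr0 // => j ji.
    by rewrite (negPf ji) mulr0n scale0r.
  rewrite /A -big_split scaler_sumr; apply: eq_bigr => j _ /=.
  by rewrite mxE -scalerA scalerDl.
(* The determinant is homogeneous of degree [n], so the scaling contributes [s ^ (- n/q)], which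
   moves to the other side as the power in [stationary_bound]. *)
rewrite detZ normrM ger0_norm ?exprn_ge0 ?powR_ge0 //.
rewrite -powR_mulrn ?powR_ge0 // -powRrM mulNr (mulrC q^-1) powRN.
rewrite [leLHS]mulrC ler_pdivrMr ?powR_gt0 // => detle.
have eB : possemidefmx (e *: B i) by apply: possemidefmxZ => //; apply: ltW.
have := le_trans (posdefmx_normdetD _ _ A (e *: B i) x Ap eB Ax) detle.
by rewrite qformZ mulrA ler_pM2l // normr_gt0 posdefmx_det.
Qed.

(** * Inequalities for power sums *)

Lemma holder_sum_le (R : realType) (I : finType) (p q : R) (b c : I -> R) :
  0 < p -> 0 < q -> p^-1 + q^-1 = 1 -> (forall i, 0 <= b i) -> (forall i, 0 <= c i) ->
  \sum_i c i `^ q <= 1 ->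
  \sum_i c i * b i <= (\sum_i b i `^ p) `^ p^-1.
Proof.
move=> p0 q0 pq b0 c0 c1; set S := _ `^ _.
have bp0 : 0 <= \sum_i b i `^ p by apply: sumr_ge0 => i _; apply: powR_ge0.
have Sp : S `^ p = \sum_i b i `^ p by rewrite -powRrM mulVf ?gt_eqF // powRr1.
have : 0 <= S by apply: powR_ge0.
(* Normalizing by [S] needs [S] nonzero; if [S = 0], every [b i] is 0. Otherwise the Young
   inequalities for [b i / S] and [c i] sum to at most [1/p + 1/q = 1]. *)
rewrite le_eqVlt => /predU1P[S0|S0].
  have bz i : b i = 0.
    move: Sp; rewrite -S0 powR0 ?gt_eqF // => /esym/eqP.
    rewrite psumr_eq0 => [/allP/(_ i (mem_index_enum i))|j _]; last exact: powR_ge0.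
    by rewrite powR_eq0 => /andP[/eqP].
  by rewrite -S0 big1 // => i _; rewrite bz mulr0.
rewrite -[leRHS]mul1r -ler_pdivrMr // mulr_suml.
apply: (@le_trans _ _ (\sum_i ((b i / S) `^ p / p + c i `^ q / q))).
  apply: ler_sum => i _; rewrite -mulrA mulrC.
  by apply: conjugate_powR => //; rewrite divr_ge0 // ltW.
rewrite big_split /= -!mulr_suml.
have -> : \sum_i (b i / S) `^ p = 1.
  under eq_bigr do rewrite powRM ?invr_ge0 ?(ltW S0) //.
  rewrite -mulr_suml -Sp -powRM ?invr_ge0 ?(ltW S0) // mulfV ?gt_eqF //.
  by rewrite powR1.
by rewrite mul1r -pq lerD2l -[leRHS]mul1r ler_wpM2r // invr_ge0 ltW.
Qed.

(** Write [b i ^ p] as [b i * b i ^ (p - 1)] and bound only the second factor: since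
    [(q - 1) * (p - 1) = 1], the power of [c i] becomes [c i] itself, and the sum collapses to
    [a]. *)
Lemma power_sum_le (R : realType) (I : finType) (p q N a : R) (b c : I -> R) :
  1 < p -> (q - 1) * (p - 1) = 1 -> 0 <= N -> 0 <= a ->
  (forall i, 0 <= b i) -> (forall i, 0 <= c i) -> \sum_i c i * b i = a ->
  (forall i, b i <= N * c i `^ (q - 1) * a) ->
  (\sum_i b i `^ p) `^ p^-1 <= N `^ (1 - p^-1) * a.
Proof.
move=> p1 pq N0 a0 b0 c0 ca bc.
have p0 : 0 < p by lra.
have -> : N `^ (1 - p^-1) * a = (N `^ (p - 1) * a `^ p) `^ p^-1.
  rewrite powRM ?powR_ge0 // -!powRrM mulfV ?gt_eqF // powRr1 //.
  by rewrite mulrBl mul1r mulfV ?gt_eqF.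
apply: ge0_ler_powR; rewrite ?invr_ge0 ?nnegrE ?(ltW p0) //.
- by apply: sumr_ge0 => i _; apply: powR_ge0.
- by rewrite mulr_ge0 ?powR_ge0.
have -> : N `^ (p - 1) * a `^ p = \sum_i N `^ (p - 1) * a `^ (p - 1) * (c i * b i).
  by rewrite -mulr_sumr ca -mulrA (mulrC _ a) mulr_powRB1.
apply: ler_sum => i _.
have cE : c i = (c i `^ (q - 1)) `^ (p - 1) by rewrite -powRrM pq powRr1.
rewrite -mulr_powRB1 // mulrA (mulrC (b i)) ler_wpM2r //.
rewrite [X in _ * X]cE -!powRM ?mulr_ge0 ?powR_ge0 //.
apply: ge0_ler_powR; rewrite ?nnegrE ?mulr_ge0 ?powR_ge0 //; first by lra.
by rewrite mulrAC.
Qed.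

(** * Positive definiteness of the maximizer and the two bounds *)

Theorem theorem5p6 (R : realType) (p : R) (hp : 1 < p) (m n r : nat)
  (B : 'I_m -> 'M[R]_n)
  (hmn : (n <= m)%N)
  (hr : (1 <= r <= n)%N)
  (hB0 : forall i, B i != 0)
  (hBpsd : forall i, possemidefmx (B i))
  (hBrank : forall i, (\rank (B i) <= r)%N)
  (hsum : \rank (\sum_(i < m) B i)%R = n) :
  exists Bstar : 'M[R]_n, posdefmx Bstar /\
    forall x : 'cV[R]_n,
      normB Bstar x ^+ 2 <= (\sum_(i < m) (qform (B i) x) `^ p) `^ p^-1 /\
      (\sum_(i < m) (qform (B i) x) `^ p) `^ p^-1
        <= n%:R `^ (1 - p^-1) * normB Bstar x ^+ 2.
Proof.
pose q := p / (p - 1).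
have p0 : 0 < p by lra.
have p10 : 0 < p - 1 by lra.
have q1 : 1 < q by rewrite ltr_pdivlMr // mul1r gtrBl.
have q0 : 0 < q by lra.
have pq : p^-1 + q^-1 = 1 by rewrite /q; field; rewrite !gt_eqF.
have qp : (q - 1) * (p - 1) = 1 by rewrite /q; field; rewrite gt_eqF.
have m0 : (0 < m)%N by case/andP: hr => r1 rn; apply: leq_trans (leq_trans r1 rn) hmn.
have [c [c0 c1 cmax]] := normdet_max R q m n B q0.
set A := \sum_i c 0 i *: B i.
have cB i : possemidefmx (c 0 i *: B i) by apply: possemidefmxZ.
have Ap : posdefmx A.
  apply: psd_posdefmx; first exact: possemidefmx_sum.
  (* The constant vector [k] meets the constraint with equality. Its determinant is [k ^+ n] times
     that of the full-rank sum, hence nonzero, so the maximum is nonzero too. *)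
  pose k : R := m%:R `^ (- q^-1).
  have k0 : 0 < k by rewrite powR_gt0 // ltr0n.
  have := cmax (const_mx k).
  have -> : \sum_i (const_mx k : 'rV[R]_m) 0 i *: B i = k *: \sum_i B i.
    by rewrite scaler_sumr; apply: eq_bigr => i _; rewrite mxE.
  rewrite detZ => kmax; rewrite -normr_gt0; apply: lt_le_trans (kmax _ _) => [|i|].
  - rewrite normr_gt0 mulf_neq0 // ?expf_neq0 ?(gt_eqF k0) //.
    by rewrite -unitfE -unitmxE -row_full_unit /row_full hsum.
  - by rewrite mxE ltW.
  - under eq_bigr do rewrite mxE.
    rewrite sumr_const card_ord -mulr_natl -powRrM mulNr mulVf ?gt_eqF //.
    by rewrite powR_inv1 // mulfV // pnatr_eq0 -lt0n.
exists A; split=> // x.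
have Ax : 0 <= qform A x by apply: (proj2 (posdefmx_psd _ _ _ Ap)).
have AE : \sum_i c 0 i * qform (B i) x = qform A x.
  by rewrite qform_sum; apply: eq_bigr => i _; rewrite qformZ.
have Bx i : 0 <= qform (B i) x by apply: (proj2 (hBpsd i)).
rewrite /normB sqr_sqrtr //; split.
  by rewrite -AE; apply: (holder_sum_le _ _ p q).
apply: (power_sum_le _ _ p q _ _ _ (fun i => c 0 i)) => // i.
exact: normdet_max_stationary.
Qed.
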